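(* Let $k$ and $s$ be positive integers with $s+1\le k\le 2s$. If $n\ge 1$, then $$b_n=k\bigl((2s-k)(q-1)\bigr)^{(n-1)/2}U_{n-1}\!\left(\frac{k+q-1}{2\sqrt{(2s-k)(q-1)}}\right)-\bigl((2s-k)(q-1)\bigr)^{n/2}U_{n-2}\!\left(\frac{k+q-1}{2\sqrt{(2s-k)(q-1)}}\right),$$ where $U_n(t)$ is the $n$-th Chebyshev polynomial of the second kind, with $U_{-1}(t)=0$.
   Context: For a $k$-ary word $\rho=\rho_1\cdots\rho_n\in\{1,\dots,k\}^n$, let $\nu(\rho)$ be the number of indices $i\in\{1,\dots,n-1\}$ with $|\rho_{i+1}-\rho_i|=s$ (occurrences of the string $a(a\pm s)$). With $q$ an indeterminate, $b_n=b_n(q)=\sum_{\rho\in\{1,\dots,k\}^n}q^{\nu(\rho)}$ for $n\ge 1$. The Chebyshev polynomials of the second kind satisfy $U_0(t)=1$, $U_1(t)=2t$, $U_{n}(t)=2tU_{n-1}(t)-U_{n-2}(t)$. With $c=(2s-k)(q-1)$ and $w=k+q-1$, the expression $c^{m/2}U_m\bigl(w/(2\sqrt{c})\bigr)$ is read as the polynomial $\sum_{j\ge 0}(-1)^j\binom{m-j}{j}w^{m-2j}c^j$ (sum over $0\le j\le m/2$) for $m\ge 0$, which gives it meaning also when $c=0$ (e.g. $k=2s$); likewise $c^{n/2}U_{n-2}(\cdot)=c\cdot c^{(n-2)/2}U_{n-2}(\cdot)$. *)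

(* Defs.v *)
From mathcomp Require Import all_boot all_order all_algebra.
From mathcomp Require Import zify ring.
Set Implicit Arguments.
Unset Strict Implicit.
Unset Printing Implicit Defensive.
Import Order.TTheory GRing.Theory Num.Theory.
Local Open Scope ring_scope.

Definition nu (s : nat) (r : seq nat) : nat :=
  count (fun i => `|nth 0 r i.+1 - nth 0 r i|%N == s) (iota 0 (size r).-1).

(* The letters 1, ..., k are the successors of the elements of 'I_k. *)
Definition b (k s n : nat) : {poly int} :=
  \sum_(rho : n.-tuple 'I_k) 'X^(nu s [seq (nat_of_ord a).+1 | a <- rho]).

Fixpoint chebyshevU (m : nat) : {poly int} :=
  match m with
  | 0 => 1
  | 1 => 2%:R * 'X
  | (m''.+1 as m').+1 => 2%:R * 'X * chebyshevU m' - chebyshevU m''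
  end.

(* c^(m/2) * U_m (w / (2 * sqrt c)), expanded so as to be a polynomial in w and
   c, meaningful even when c = 0 or c has no square root; chebyshevU_homE below
   relates it to chebyshevU. The value at m = -1 encodes U_(-1) = 0; the values
   at m < -1 are junk. *)
Definition chebyshevU_hom (R : comNzRingType) (w c : R) (m : int) : R :=
  match m with
  | Posz m =>
      \sum_(0 <= j < m./2.+1) (-1) ^+ j * 'C(m - j, j)%:R * w ^+ (m - 2 * j) * c ^+ j
  | Negz _ => 0
  end.

Lemma chebyshevU_hom_widen (R : comNzRingType) (w c : R) (m N : nat) :
  (m./2 < N)%N ->
  chebyshevU_hom w c m =
  \sum_(0 <= j < N) (-1) ^+ j * 'C(m - j, j)%:R * w ^+ (m - 2 * j) * c ^+ j.
Proof.
move=> ltmN; rewrite /chebyshevU_hom [RHS](big_cat_nat (n := m./2.+1)) //=.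
rewrite [X in _ + X]big_nat_cond [X in _ + X]big1 ?addr0 // => j.
rewrite andbT => /andP[ltmj _]; rewrite bin_small; last by lia.
by rewrite mulr0 !mul0r.
Qed.

Lemma chebyshevU_homSS (R : comNzRingType) (w c : R) (m : nat) :
  chebyshevU_hom w c m.+2 =
  w * chebyshevU_hom w c m.+1 - c * chebyshevU_hom w c m.
Proof.
rewrite (@chebyshevU_hom_widen _ _ _ m.+2 m.+3); last by lia.
rewrite (@chebyshevU_hom_widen _ _ _ m.+1 m.+3); last by lia.
rewrite (@chebyshevU_hom_widen _ _ _ m m.+2); last by lia.
rewrite !mulr_sumr [LHS]big_nat_recl // [X in X - _]big_nat_recl // -addrA.
congr (_ + _); first by rewrite !subn0 !bin0 exprS; ring.
rewrite -sumrB; apply: eq_bigr => j _.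
have -> : (m.+2 - j.+1 = m.+1 - j)%N by lia.
have -> : (m.+1 - j.+1 = m - j)%N by lia.
have -> : (m.+2 - 2 * j.+1 = m - 2 * j)%N by lia.
have [le_jm|lt_mj] := leqP j m; last first.
  have -> : (m.+1 - j = 0)%N by lia.
  have -> : (m - j = 0)%N by lia.
  by rewrite !bin_small; [ring | lia..].
rewrite subSn // binS natrD.
have [lt_jm|le_mj] := ltnP (2 * j) m.
  have -> : (m - 2 * j = (m.+1 - 2 * j.+1).+1)%N by lia.
  by rewrite !exprS; ring.
by rewrite (@bin_small _ j.+1); [rewrite !exprS; ring | lia].
Qed.

Lemma chebyshevU_homE (F : fieldType) (w r : F) (m : nat) :
  2%:R != 0 :> F -> r != 0 ->
  chebyshevU_hom w (r ^+ 2) m =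
  r ^+ m * (map_poly intr (chebyshevU m)).[w / (2%:R * r)].
Proof.
move=> n2 nr.
suff [] : chebyshevU_hom w (r ^+ 2) m =
          r ^+ m * (map_poly intr (chebyshevU m)).[w / (2%:R * r)]
       /\ chebyshevU_hom w (r ^+ 2) m.+1 =
          r ^+ m.+1 * (map_poly intr (chebyshevU m.+1)).[w / (2%:R * r)] by [].
elim: m => [|m [IH0 IH1]].
  split; rewrite /chebyshevU_hom big_nat1 bin0.
    by rewrite /= [map_poly _ _]rmorph1 hornerC !expr0 !mulr1.
  rewrite /= rmorphM /= map_polyX rmorph_nat hornerM hornerX -polyC_natr hornerC.
  by rewrite !expr0 !expr1; field; rewrite nr n2.
split=> //; rewrite chebyshevU_homSS IH0 IH1.
have -> : chebyshevU m.+2 = 2%:R * 'X * chebyshevU m.+1 - chebyshevU m by [].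
move: (chebyshevU m.+1) (chebyshevU m) => p1 p0.
rewrite rmorphB /= !rmorphM /= map_polyX rmorph_nat.
rewrite -polyC_natr hornerD hornerN !hornerM hornerC hornerX.
move: (horner _ _) (horner _ _) => y1 y0.
by rewrite !exprS; field; rewrite nr n2.
Qed.

(* Main.v *)
Require Import Defs.
From mathcomp Require Import all_boot all_order all_algebra.
From mathcomp Require Import zify ring.
Import Order.TTheory GRing.Theory Num.Theory.
Local Open Scope ring_scope.

(** Build words letter by letter from the left, and join two letters by an edge
    when they differ by [s].  The condition [k <= 2 * s] prevents [a - s] and
    [a + s] from both being letters, so this graph on the [k] letters is a
    matching; it has [k - s] edges, hence [M = 2 * (k - s)] matched letters.

    For a matching the transfer operator closes up on two quantities: the total
    weight [W n] of the words of length [n + 1], and the weight [A n] of those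
    whose first letter is matched.  Prepending a letter [x] to a word multiplies
    its weight by [1], plus [q - 1] if the word begins with the partner of [x].
    Summing over all [x], respectively over the matched [x],
      [W (n + 1) = k * W n + (q - 1) * A n],
      [A (n + 1) = M * W n + (q - 1) * A n]:
    the second sum keeps the whole of [A n] because partners of matched letters
    are matched ([matched_sumS]).  Eliminating [A] gives
      [W (n + 2) = (k + q - 1) * W (n + 1) - (k - M) * (q - 1) * W n]
    ([total_sumSS]), with [k - M = 2 * s - k].  This is the recurrence
    [chebyshevU_homSS] of the homogenized Chebyshev polynomials, so the formula
    follows by comparing the first two values ([total_sum_chebyshev]). *)

(** The transfer operator of [e] iterated on the constant [1]; it adds up the
    words of [n + 1] letters beginning with [x], each weighted by [q] to the
    number of its adjacent pairs joined by [e]. *)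
Fixpoint word_sum {T : finType} {R : comNzRingType} (e : rel T) (q : R)
    (n : nat) (x : T) : R :=
  if n is m.+1 then \sum_y q ^+ e x y * word_sum e q m y else 1.

Definition total_sum {T : finType} {R : comNzRingType} (e : rel T) (q : R)
    (n : nat) : R := \sum_x word_sum e q n x.

(** In a matching the degree is the indicator of the matched letters, so this is
    the weight of the words whose first letter is matched. *)
Definition matched_sum {T : finType} {R : comNzRingType} (e : rel T) (q : R)
    (n : nat) : R := \sum_x #|e x|%:R * word_sum e q n x.

(** Write the weight [q ^+ e x y] as [1 + (q - 1) * e x y]: only the edges at [x]
    see the second term. *)
Lemma word_sumS (T : finType) (R : comNzRingType) (e : rel T) (q : R) n x :
  word_sum e q n.+1 x =
  total_sum e q n + (q - 1) * \sum_(y | e x y) word_sum e q n y.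
Proof.
rewrite /= /total_sum [X in _ * X]big_mkcond mulr_sumr -big_split /=.
by apply: eq_bigr => y _; case: (e x y); rewrite ?expr1 ?expr0; ring.
Qed.

Lemma total_sumS (T : finType) (R : comNzRingType) (e : rel T) (q : R) n :
  symmetric e ->
  total_sum e q n.+1 = #|T|%:R * total_sum e q n + (q - 1) * matched_sum e q n.
Proof.
move=> e_sym; rewrite {1}/total_sum.
under [LHS]eq_bigr do rewrite word_sumS.
rewrite big_split /= sumr_const mulr_natl -mulr_sumr; congr (_ + _ * _).
rewrite (exchange_big_dep xpredT) //=; apply: eq_bigr => y _.
rewrite sumr_const mulr_natl; congr (_ *+ _).
by apply: eq_card => x; rewrite -!topredE /= e_sym.
Qed.

(** Exchanging the sums, each word starting at [y] is counted once for every
    matched neighbour of [y]; in a matching a neighbour of [y] has degree 1, so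
    the number of such neighbours is again the degree of [y]. *)
Lemma matched_sumS (T : finType) (R : comNzRingType) (e : rel T) (q : R) n :
  symmetric e -> (forall x y z, e x y -> e x z -> y = z) ->
  matched_sum e q n.+1 =
  (\sum_x #|e x|)%N%:R * total_sum e q n + (q - 1) * matched_sum e q n.
Proof.
move=> e_sym e_inj; rewrite {1}/matched_sum.
under [LHS]eq_bigr do rewrite word_sumS mulrDr mulrCA.
rewrite big_split /= -mulr_suml -natr_sum -mulr_sumr; congr (_ + _ * _).
under eq_bigr do rewrite mulr_sumr.
rewrite (exchange_big_dep xpredT) //=; apply: eq_bigr => y _.
rewrite -mulr_suml -natr_sum; congr (_%:R * _).
rewrite -sum1_card; apply: eq_big => [x|x e_xy]; first by rewrite e_sym.
by apply: (@eq_card1 _ y) => z; apply/idP/eqP => [/(e_inj _ _ _ e_xy)|->].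
Qed.

(** Eliminate [matched_sum] between the two first-order recurrences. *)
Lemma total_sumSS (T : finType) (R : comNzRingType) (e : rel T) (q : R) n :
  symmetric e -> (forall x y z, e x y -> e x z -> y = z) ->
  total_sum e q n.+2 =
  (#|T|%:R + q - 1) * total_sum e q n.+1
  - (#|T|%:R - (\sum_x #|e x|)%N%:R) * (q - 1) * total_sum e q n.
Proof.
move=> e_sym e_inj; rewrite [LHS]total_sumS // matched_sumS //.
by rewrite [total_sum _ _ n.+1]total_sumS //; ring.
Qed.

Lemma total_sum_chebyshev (T : finType) (R : comNzRingType) (e : rel T) (q : R)
    (n : nat) :
  symmetric e -> (forall x y z, e x y -> e x z -> y = z) ->
  let c := (#|T|%:R - (\sum_x #|e x|)%N%:R) * (q - 1) in
  let w := #|T|%:R + q - 1 in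
  total_sum e q n =
  #|T|%:R * chebyshevU_hom w c n - c * chebyshevU_hom w c (n%:Z - 1).
Proof.
move=> e_sym e_inj c w.
have U0 : chebyshevU_hom w c 0%N = 1.
  by rewrite /chebyshevU_hom big_nat1 bin0 !expr0 !mulr1.
(* The value 0 at index -1 makes the recurrence valid from U_1 on. *)
have U_rec m :
    chebyshevU_hom w c m.+1 =
    w * chebyshevU_hom w c m - c * chebyshevU_hom w c (m%:Z - 1).
  case: m => [|m]; last first.
    have -> : m.+1%:Z - 1 = m by lia.
    exact: chebyshevU_homSS.
  rewrite U0 /= /chebyshevU_hom big_nat1 bin0 !expr0 expr1 /=; ring.
have W0 : total_sum e q 0 = #|T|%:R by rewrite /total_sum sumr_const.
have A0 : matched_sum e q 0 = (\sum_x #|e x|)%N%:R.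
  by rewrite /matched_sum natr_sum; apply: eq_bigr => x _; rewrite mulr1.
suff [] : total_sum e q n =
    #|T|%:R * chebyshevU_hom w c n - c * chebyshevU_hom w c (n%:Z - 1)
  /\ total_sum e q n.+1 =
    #|T|%:R * chebyshevU_hom w c n.+1 - c * chebyshevU_hom w c n by [].
elim: n => [|n [IH0 IH1]].
  split; first by rewrite W0 U0 /=; ring.
  by rewrite total_sumS // W0 A0 U_rec U0 /= /c /w; ring.
have -> : n.+1%:Z - 1 = n by lia.
split=> //; rewrite total_sumSS // -/w -/c IH0 IH1 chebyshevU_homSS.
by rewrite (U_rec n); ring.
Qed.

Definition at_distance (s k : nat) : rel 'I_k :=
  fun x y => `|y%:Z - x%:Z|%N == s.

Lemma at_distance_sym (s k : nat) : symmetric (at_distance s k).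
Proof. by move=> x y; rewrite /at_distance distnC. Qed.

(** Two distinct letters at distance [s] from [x] would be [x - s] and [x + s],
    which are [2 * s >= k] apart. *)
Lemma at_distance_inj (s k : nat) (x y z : 'I_k) :
  (k <= 2 * s)%N -> at_distance s k x y -> at_distance s k x z -> y = z.
Proof.
rewrite /at_distance => k_le_2s /eqP xy /eqP xz; apply: val_inj => /=.
have := ltn_ord x; have := ltn_ord y; have := ltn_ord z; lia.
Qed.

(** There are [k - s] pairs [(x, x + s)] of letters; since [s] is nonzero, each is
    counted exactly once from either end. *)
Lemma sum_degree_at_distance (s k : nat) :
  (0 < s)%N -> (\sum_x #|at_distance s k x| = 2 * (k - s))%N.
Proof.
move=> s_gt0.
have count_shift : (\sum_(x < k) \sum_(y < k) (y == x + s :> nat) = k - s)%N.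
  have -> : (\sum_(x < k) \sum_(y < k) (y == x + s :> nat) =
             \sum_(x < k) (x < k - s))%N.
    apply: eq_bigr => x _; case: ltnP => [lt_x|le_x].
      have xs_lt : (x + s < k)%N by lia.
      rewrite (bigD1 (Ordinal xs_lt)) //= eqxx big1 // => y.
      by rewrite -val_eqE /= => /negbTE->.
    by rewrite big1 // => y _; apply/eqP; rewrite eqb0; have := ltn_ord y; lia.
  by rewrite -big_mkcond /= -(big_ord_widen k (fun=> 1%N)) ?leq_subr // sum1_card card_ord.
have -> : (2 * (k - s) = (k - s) + (k - s))%N by lia.
rewrite -{1}count_shift -count_shift [X in (_ + X)%N]exchange_big -big_split /=.
apply: eq_bigr => x _; rewrite -big_split -sum1_card big_mkcond /=.
apply: eq_bigr => y _; rewrite -topredE /= /at_distance.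
by do 3 case: eqP => ? //=; lia.
Qed.

Lemma sum_tupleS (T : finType) (V : nmodType) n (F : seq T -> V) :
  \sum_(t : n.+1.-tuple T) F t = \sum_x \sum_(t : n.-tuple T) F (x :: t).
Proof.
rewrite pair_bigA /=.
rewrite (reindex (fun p : T * n.-tuple T => [tuple of p.1 :: p.2])) //=.
exists (fun t => (thead t, [tuple of behead t])) => [[x t]|t] _ /=.
  by rewrite theadE; congr (_, _); apply: val_inj.
by rewrite [RHS]tuple_eta; apply: val_inj.
Qed.

Lemma nu_cons (s x y : nat) (r : seq nat) :
  nu s (x :: y :: r) = ((`|y%:Z - x%:Z|%N == s) + nu s (y :: r))%N.
Proof. by rewrite /nu /= -[1%N]addn0 iotaDl count_map. Qed.

(** The shift of the letters from [0..k-1] to [1..k] does not affect distances,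
    so the occurrences counted by [nu] are the edges of [at_distance]. *)
Lemma word_sumE (s k n : nat) (x : 'I_k) :
  \sum_(t : n.-tuple 'I_k) 'X^(nu s [seq (nat_of_ord a).+1 | a <- x :: t]) =
  word_sum (at_distance s k) ('X : {poly int}) n x.
Proof.
elim: n x => [|n IH] x.
  rewrite (big_pred1 [tuple]) => [|t]; last by apply/esym/eqP; exact: tuple0.
  by rewrite /nu.
rewrite (sum_tupleS _ _ _ (fun t : seq 'I_k =>
  'X^(nu s [seq (nat_of_ord a).+1 | a <- x :: t]))).
rewrite [RHS]/=; apply: eq_bigr => y _; rewrite -IH mulr_sumr; apply: eq_bigr => t _.
rewrite !map_cons nu_cons exprD; congr ('X^(nat_of_bool (_ == _)) * _); lia.
Qed.

Lemma b_total_sum (s k n : nat) :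
  b k s n.+1 = total_sum (at_distance s k) 'X n.
Proof.
rewrite /b (sum_tupleS _ _ _ (fun t : seq 'I_k =>
  'X^(nu s [seq (nat_of_ord a).+1 | a <- t]))).
by apply: eq_bigr => x _; rewrite word_sumE.
Qed.

Theorem theorem5p1 (k s n : nat) (s_gt0 : (0 < s)%N) (k_gt0 : (0 < k)%N)
    (s_lt_k : (s + 1 <= k)%N) (k_le_2s : (k <= 2 * s)%N) (n_ge1 : (1 <= n)%N) :
  let q : {poly int} := 'X in
  let c : {poly int} := (2%:R * s%:R - k%:R) * (q - 1) in
  let w : {poly int} := k%:R + q - 1 in
  b k s n = k%:R * chebyshevU_hom w c (n%:Z - 1)
            - c * chebyshevU_hom w c (n%:Z - 2).
Proof.
case: n n_ge1 => // n _ q c w.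
have -> : n.+1%:Z - 1 = n by lia.
have -> : n.+1%:Z - 2 = n%:Z - 1 by lia.
rewrite b_total_sum total_sum_chebyshev; first last.
- by move=> x y z; apply: at_distance_inj.
- exact: at_distance_sym.
rewrite card_ord sum_degree_at_distance //.
have -> : k%:R - (2 * (k - s))%:R = 2%:R * s%:R - k%:R :> {poly int}.
  by rewrite natrM natrB; [ring | lia].
by [].
Qed.
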